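(* For a Banach space $Y$, the following assertions are equivalent. (1) There is a separable pointed metric space $M$ and a closed linear subspace $Z\subset\mathrm{Lip}_0(M)$ such that $Z$ is isometric to $Y$ and $Z\subset\mathrm{SNA}(M)$. (2) There is a separable Banach space $X$ and a closed linear subspace $Z_1\subset X^*$ such that $Z_1$ is isometric to $Y$ and $Z_1\subset\mathrm{NA}(X,\mathbb{R})$. (3) $Y^*$ is separable.
   Context: All vector spaces are real; $X^*$ is the topological dual of $X$ (with the dual norm), and ''isometric'' for Banach spaces means linearly isometric. A pointed metric space $(M,\rho)$ is a metric space with at least 2 points and a distinguished point $0\in M$. $\mathrm{Lip}_0(M)$ is the Banach space of all Lipschitz functions $f:M\to\mathbb{R}$ with $f(0)=0$, normed by the Lipschitz constant $\|f\|=\sup\{|f(x)-f(y)|/\rho(x,y): x,y\in M,\ x\neq y\}$. A function $f\in\mathrm{Lip}_0(M)$ attains its norm strongly if there are $x\neq y$ in $M$ with $\|f\|=|f(x)-f(y)|/\rho(x,y)$; $\mathrm{SNA}(M)\subset\mathrm{Lip}_0(M)$ is the set of all such $f$. $\mathrm{NA}(X,\mathbb{R})\subset X^*$ is the set of bounded linear functionals $f$ on $X$ that attain their norm, i.e. for which there is $x$ in the closed unit ball $B_X$ with $|f(x)|=\|f\|$. *)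

(* Defs.v *)
From HB Require Import structures.
From mathcomp Require Import all_boot all_order all_algebra.
From mathcomp Require Import all_classical all_reals all_analysis.

Set Implicit Arguments.
Unset Strict Implicit.
Unset Printing Implicit Defensive.

Import Order.TTheory GRing.Theory Num.Theory.
Import numFieldNormedType.Exports.

Local Open Scope classical_set_scope.
Local Open Scope ring_scope.

Definition separable (T : topologicalType) : Prop :=
  exists2 D : set T, countable D & dense D.

Definition closed_subspace (R : realType) (V : normedModType R) (Z : set V) :
    Prop :=
  GRing.submod_closed (mem Z) /\ closed Z.

Definition isometric_to_subspace (R : realType) (Y V : normedModType R)
    (Z : set V) : Prop :=
  exists2 phi : {linear Y -> V},
    (forall y, `|phi y| = `|y|) & range phi = Z.

Section lip0_space.
Context {R : realType} {M : metricType R} (o : M).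

(* MathComp-Analysis defines [lipschitz] only between normed modules. *)
Definition is_lipschitz (f : M -> R) : Prop :=
  exists k : R, forall x y, `|f x - f y| <= k * mdist x y.

Definition lip0_mem : {pred (M -> R^o)} :=
  mem [set f : M -> R^o | f o = 0 /\ is_lipschitz f].

Lemma lip0_submod_closed : GRing.submod_closed lip0_mem.
Proof.
split.
  apply/mem_set; split => //; exists 0 => x y.
  by rewrite subr0 normr0 mul0r.
move=> a f g /set_mem[f0 [k fk]] /set_mem[g0 [l gl]].
apply/mem_set; split => [|]; first by rewrite /= !fctE f0 g0 scaler0 addr0.
exists (`|a| * k + l) => x y.
have -> : (a *: f + g) x - (a *: f + g) y = a * (f x - f y) + (g x - g y).
  by rewrite !fctE /= -![a *: _]/(a * _) mulrBr opprD addrACA.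
rewrite mulrDl -mulrA (le_trans (ler_normD _ _))// lerD// normrM.
by rewrite ler_wpM2l.
Qed.

HB.instance Definition _ := GRing.isSubmodClosed.Build _ _ lip0_mem
  lip0_submod_closed.

Record lip0 : Type := Lip0 {
  lip0_fun :> M -> R^o ;
  lip0P : lip0_fun \in lip0_mem }.

HB.instance Definition _ := [isSub for lip0_fun].
HB.instance Definition _ := [Choice of lip0 by <:].
HB.instance Definition _ := [SubChoice_isSubLmodule of lip0 by <:].

Lemma lip0_base (f : lip0) : f o = 0.
Proof. by case: f => f /= /set_mem[]. Qed.

Lemma lip0_lipschitz (f : lip0) : is_lipschitz f.
Proof. by case: f => f /= /set_mem[]. Qed.

Definition slopes (f : M -> R) : set R :=
  [set r | exists x y, x != y /\ r = `|f x - f y| / mdist x y].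

Definition lip0_norm (f : lip0) : R := sup (slopes f).

Lemma slopes_ub (f : lip0) : has_ubound (slopes f).
Proof.
have [k fk] := lip0_lipschitz f.
exists k => _ [x [y [xy ->]]].
by rewrite ler_pdivrMr ?mdist_gt0.
Qed.

Lemma lip0_norm_ge0 (f : lip0) : 0 <= lip0_norm f.
Proof.
have [[r sr]|/set0P/negP/negPn/eqP s0] := pselect (slopes f !=set0); last first.
  by rewrite /lip0_norm s0 sup0.
apply: le_trans (ub_le_sup (slopes_ub f) sr).
by case: sr => x [y [_ ->]]; rewrite divr_ge0 ?mdist_ge0.
Qed.

Lemma lip0_normP (f : lip0) x y : `|f x - f y| <= lip0_norm f * mdist x y.
Proof.
have [->|xy] := eqVneq x y; first by rewrite subrr normr0 mdistxx mulr0.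
rewrite -ler_pdivrMr ?mdist_gt0//.
by apply: ub_le_sup; [exact: slopes_ub | exists x, y].
Qed.

Lemma lip0_norm_le (f : lip0) (k : R) : 0 <= k ->
  (forall x y, `|f x - f y| <= k * mdist x y) -> lip0_norm f <= k.
Proof.
move=> k0 fk.
have [s0|/set0P/negP/negPn/eqP s0] := pselect (slopes f !=set0); last first.
  by rewrite /lip0_norm s0 sup0.
apply: ge_sup => // _ [x [y [xy ->]]].
by rewrite ler_pdivrMr ?mdist_gt0.
Qed.

Lemma lip0_normD (f g : lip0) :
  lip0_norm (f + g) <= lip0_norm f + lip0_norm g.
Proof.
apply: lip0_norm_le => [|x y]; first by rewrite addr_ge0 ?lip0_norm_ge0.
rewrite mulrDl (le_trans _ (lerD (lip0_normP f x y) (lip0_normP g x y)))//.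
by rewrite /= !fctE opprD addrACA ler_normD.
Qed.

Lemma lip0_normZ_le (a : R) (f : lip0) :
  lip0_norm (a *: f) <= `|a| * lip0_norm f.
Proof.
apply: lip0_norm_le => [|x y]; first by rewrite mulr_ge0 ?lip0_norm_ge0.
by rewrite /= !fctE -scalerBr normrM -mulrA ler_wpM2l ?lip0_normP.
Qed.

Lemma lip0_normZ (a : R) (f : lip0) :
  lip0_norm (a *: f) = `|a| * lip0_norm f.
Proof.
apply/eqP; rewrite eq_le lip0_normZ_le /=.
have [->|a0] := eqVneq a 0; first by rewrite normr0 mul0r lip0_norm_ge0.
rewrite -ler_pdivlMl ?normr_gt0// -normfV.
by rewrite -{1}[f](scalerK a0) lip0_normZ_le.
Qed.

Lemma lip0_norm_eq0 (f : lip0) : lip0_norm f = 0 -> f = 0.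
Proof.
move=> f0; apply/val_inj/funext => x /=.
have := lip0_normP f x o.
by rewrite f0 mul0r lip0_base subr0 normr_le0 => /eqP.
Qed.

HB.instance Definition _ := Lmodule_isNormed.Build R lip0
  lip0_normD lip0_normZ lip0_norm_eq0.

Lemma lip0_normE (f : lip0) :
  `|f| = sup [set r | exists x y, x != y /\ r = `|f x - f y| / mdist x y].
Proof. by []. Qed.

Definition SNA : set lip0 :=
  [set f : lip0 | exists x y : M, x != y /\ `|f| = `|f x - f y| / mdist x y].

End lip0_space.

Arguments SNA {R M} o.

Section dual.
Context {R : realType} (X : normedModType R).

Definition dual_mem : {pred (X -> R^o)} :=
  mem [set f : X -> R^o | linear f /\ continuous f].

Lemma dual_submod_closed : GRing.submod_closed dual_mem.
Proof.
split.
  apply/mem_set; split => [a x y|]; first by rewrite -[RHS]/(a *: 0 + 0) scaler0 addr0.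
  exact: cst_continuous.
move=> a f g /set_mem[lf cf] /set_mem[lg cg]; apply/mem_set; split.
  move=> b x y; rewrite -[LHS]/(a *: f _ + g _).
  rewrite -[RHS]/(b *: (a *: f x + g x) + (a *: f y + g y)).
  rewrite lf lg !scalerDr addrACA; congr (_ + _ + _).
  by rewrite !scalerA mulrC.
by move=> x; exact: (cvgD (cvgZl_tmp (cf x)) (cg x)).
Qed.

HB.instance Definition _ := GRing.isSubmodClosed.Build _ _ dual_mem
  dual_submod_closed.

Record dual : Type := Dual {
  dual_fun :> X -> R^o ;
  dualP : dual_fun \in dual_mem }.

HB.instance Definition _ := [isSub for dual_fun].
HB.instance Definition _ := [Choice of dual by <:].
HB.instance Definition _ := [SubChoice_isSubLmodule of dual by <:].

Lemma dual_linear (f : dual) : linear f.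
Proof. by case: f => f /= /set_mem[]. Qed.

HB.instance Definition _ (f : dual) :=
  GRing.isLinear.Build R X R^o _ f (dual_linear f).

Lemma dual_continuous (f : dual) : continuous f.
Proof. by case: f => f /= /set_mem[]. Qed.

Definition dual_norm (f : dual) : R :=
  sup [set `|f x| | x in [set x : X | `|x| <= 1]].

Lemma dual_values_ub (f : dual) :
  has_ubound [set `|f x| | x in [set x : X | `|x| <= 1]].
Proof.
have /linear_bounded_continuous/linear_boundedP := @dual_continuous f.
move=> [M [_ /(_ (`|M| + 1))]].
rewrite (le_lt_trans (ler_norm M)) ?ltrDl// => /(_ isT) fM.
exists (`|M| + 1) => _ [x /= x1 <-].
by rewrite (le_trans (fM x))// ler_piMr// addr_ge0.
Qed.

Lemma dual_norm_ge0 (f : dual) : 0 <= dual_norm f.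
Proof.
apply: (ub_le_sup (dual_values_ub f)); exists 0 => /=; first by rewrite normr0.
by rewrite linear0 normr0.
Qed.

Lemma dual_normP (f : dual) x : `|f x| <= dual_norm f * `|x|.
Proof.
have [->|x0] := eqVneq x 0; first by rewrite linear0 !normr0 mulr0.
have nx : 0 < `|x| by rewrite normr_gt0.
rewrite -ler_pdivrMr//; apply: (ub_le_sup (dual_values_ub f)).
exists (`|x|^-1 *: x) => /=.
  by rewrite normrZ normfV normr_id mulVf// gt_eqF.
by rewrite linearZ /= normrM normfV normr_id mulrC.
Qed.

Lemma dual_norm_le (f : dual) (k : R) : 0 <= k ->
  (forall x, `|f x| <= k * `|x|) -> dual_norm f <= k.
Proof.
move=> k0 fk; apply: ge_sup.
  by exists `|f 0|, 0 => //=; rewrite normr0.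
by move=> _ [x /= x1 <-]; rewrite (le_trans (fk x))// ler_piMr.
Qed.

Lemma dual_normD (f g : dual) : dual_norm (f + g) <= dual_norm f + dual_norm g.
Proof.
apply: dual_norm_le => [|x]; first by rewrite addr_ge0 ?dual_norm_ge0.
rewrite mulrDl (le_trans _ (lerD (dual_normP f x) (dual_normP g x)))//.
by rewrite /= !fctE ler_normD.
Qed.

Lemma dual_normZ_le (a : R) (f : dual) :
  dual_norm (a *: f) <= `|a| * dual_norm f.
Proof.
apply: dual_norm_le => [|x]; first by rewrite mulr_ge0 ?dual_norm_ge0.
by rewrite /= !fctE normrM -mulrA ler_wpM2l ?dual_normP.
Qed.

Lemma dual_normZ (a : R) (f : dual) :
  dual_norm (a *: f) = `|a| * dual_norm f.
Proof.
apply/eqP; rewrite eq_le dual_normZ_le /=.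
have [->|a0] := eqVneq a 0; first by rewrite normr0 mul0r dual_norm_ge0.
rewrite -ler_pdivlMl ?normr_gt0// -normfV.
by rewrite -{1}[f](scalerK a0) dual_normZ_le.
Qed.

Lemma dual_norm_eq0 (f : dual) : dual_norm f = 0 -> f = 0.
Proof.
move=> f0; apply/val_inj/funext => x /=.
by have := dual_normP f x; rewrite f0 mul0r normr_le0 => /eqP.
Qed.

HB.instance Definition _ := Lmodule_isNormed.Build R dual
  dual_normD dual_normZ dual_norm_eq0.

Lemma dual_normE (f : dual) :
  `|f| = sup [set `|f x| | x in [set x : X | `|x| <= 1]].
Proof. by []. Qed.

Definition NA : set dual :=
  [set f : dual | exists2 x : X, `|x| <= 1 & `|f x| = `|f|].

End dual.

Arguments NA {R} X.

(* Main.v *)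
From HB Require Import structures.
Require Import Defs.
From mathcomp Require Import all_boot all_order all_algebra.
From mathcomp Require Import all_classical all_reals all_analysis.
From mathcomp Require Import ring lra.
Import numFieldNormedType.Exports.
Import Order.TTheory GRing.Theory Num.Theory.
Local Open Scope classical_set_scope.
Local Open Scope ring_scope.

(** Write the evaluations attached to an isometric copy of [Y] as elements of
    [dual Y]: a point [p] of [M] gives [y |-> phi y p], a point [x] of [X]
    gives [y |-> phi y x]. Both maps are continuous into [dual Y], hence have
    separable range. To say that every element of the copy attains its norm is
    to say that every [y] in [Y] is normed by a functional of norm at most 1
    obtained from this range: a molecule [(e p - e q) / mdist p q] in the
    Lipschitz case, an evaluation [e x] in the dual case. So [Y] has a James
    boundary lying in the closed span of a sequence [b] of functionals, and
    both implications towards the separability of [dual Y] follow from the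
    theorem of Godefroy that such a [b] spans a dense subspace
    ([separable_dual_of_boundary]).

    Suppose that it does not: some [f] stays at distance more than [d > 0] from
    the span of [b]. By Hahn-Banach, for each [n] the slice [C n] of those [y]
    in the unit ball that are killed by [b 0], ..., [b n.-1] and satisfy [d <=
    f y] is nonempty ([functional_large_on_kernel]). A functional of the
    boundary is uniformly small on [C n] for large [n], because up to a small
    error it is a combination of the first few [b i]. But the construction of
    Simons ([simons]) yields a point [x], the sum of [2^-(n+1) z_n] with [z_n]
    in [C n] chosen greedily so that partial sums have almost minimal norm,
    such that every functional norming [x] is bounded below on every [C n] at
    the point given by the rescaled tail of the series. Applied to the boundary
    functional norming [x], this is a contradiction.

    Conversely, if [dual Y] is separable, it serves as [X]: [Y] embeds in its
    bidual, and by Hahn-Banach every [y] attains its norm on [dual Y]. The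
    underlying metric space of [X] serves as [M], since a functional attaining
    its norm at [x] attains its Lipschitz constant at the pair [x], [0]. When
    [Y] is zero, [dual Y] is a single point and the scalar field replaces it. *)

Set Implicit Arguments.
Unset Strict Implicit.
Unset Printing Implicit Defensive.

(** * Hahn-Banach theorem *)

Section HahnBanach.
Context {R : realType} {V : lmodType R} (p : V -> R).
Hypothesis pD : forall x y, p (x + y) <= p x + p y.
Hypothesis pZ : forall a x, 0 <= a -> p (a *: x) = a * p x.

(** Partial linear functionals are represented by their graphs, so that the
    order used in Zorn's lemma is inclusion and the supremum of a chain is its
    union. The domination clause makes such a relation single-valued. *)
Definition dominated_graph (G : set (V * R^o)) : Prop :=
  [/\ G 0, (forall a u v, G u -> G v -> G (a *: u + v)) &
      forall u, G u -> u.2 <= p u.1].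

(** One-dimensional extension: a value [c] at [x] is admissible as soon as [u.2
    - p (u.1 - x) <= c <= p (u.1 + x) - u.2] for all [u] in the graph, and
    subadditivity of [p] shows that the lower bounds lie below the upper ones. *)
Lemma dominated_graph_extend G x : dominated_graph G ->
  exists2 H, dominated_graph H & G `<=` H /\ exists c, H (x, c).
Proof.
move=> [G0 GL Gp].
have GZ a u : G u -> G (a *: u) by move=> Gu; rewrite -[_ *: _]addr0; exact: GL.
pose S := [set u.2 - p (u.1 - x) | u in G].
have Sub u v : G u -> G v -> u.2 - p (u.1 - x) <= p (v.1 + x) - v.2.
  move=> Gu Gv; rewrite lerBlDr addrAC lerBrDr.
  have := Gp _ (GL 1 u v Gu Gv); rewrite scale1r => /le_trans; apply.
  rewrite (_ : (u + v).1 = (v.1 + x) + (u.1 - x)) ?pD//.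
  by rewrite addrACA subrr addr0 addrC.
have S0 : S !=set0 by exists (0 - p (0 - x)), 0.
have Sb : has_ubound S.
  by exists (p (0 + x) - 0) => _ [u Gu <-]; exact: (Sub u 0).
pose c := sup S.
have cl u : G u -> u.2 - p (u.1 - x) <= c.
  by move=> Gu; apply: ub_le_sup => //; exists u.
have cu v : G v -> c <= p (v.1 + x) - v.2.
  by move=> Gv; apply: ge_sup => // _ [u Gu <-]; exact: Sub.
exists [set w | exists t, G (w - t *: ((x, c) : V * R^o))].
  split.
  - by exists 0; rewrite scale0r subr0.
  - move=> a u v [s Gs] [t Gt]; exists (a * s + t).
    rewrite scalerDl opprD addrACA -scalerA -scalerBr; exact: GL.
  - move=> [y r] [t /=]; set w := _ - _ => Gw.
    (* the upper bound on [c] serves for [t > 0], the lower one for [t < 0] *)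
    have [t0|t0|t0] := ltgtP t 0; last first.
    + by have := Gp _ Gw; rewrite /w t0 scale0r subr0.
    + have := ler_wpM2l (ltW t0) (cu _ (GZ t^-1 _ Gw)).
      rewrite /= mulrBr -pZ ?(ltW t0)// scalerDr scalerKV ?gt_eqF//.
      rewrite -[t^-1 *: (r - _)]/(t^-1 * _) mulVKf ?gt_eqF// subrK.
      by rewrite opprB addrCA lerDl subr_ge0.
    + have nt : 0 < - t by rewrite oppr_gt0.
      have := ler_wpM2l (ltW nt) (cl _ (GZ (- t)^-1 _ Gw)).
      rewrite /= mulrBr -pZ ?(ltW nt)// [X in p X]scalerDr scalerKV ?gt_eqF//.
      rewrite -[(- t)^-1 *: (r - _)]/((- t)^-1 * _) mulVKf ?gt_eqF//.
      rewrite scaleNr scalerN opprK subrK mulNr.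
      by rewrite addrAC gerDr subr_le0.
split; first by move=> w Gw; exists 0; rewrite scale0r subr0.
by exists c, 1; rewrite scale1r subrr.
Qed.

Theorem hahn_banach G : dominated_graph G ->
  exists f : V -> R^o,
    [/\ linear f, (forall x, f x <= p x) & forall u, G u -> f u.1 = u.2].
Proof.
move=> domG.
pose T := {H : set (V * R^o) | dominated_graph H /\ G `<=` H}.
pose leT (s t : T) := `[< sval s `<=` sval t >].
have [] := @Zorn T leT.
- by move=> t; apply/asboolP.
- move=> r s t /asboolP rs /asboolP st; apply/asboolP; exact: subset_trans st.
- move=> [s ps] [t pt] /asboolP/= st /asboolP/= ts.
  by apply: eq_exist; apply/seteqP.
- move=> A totA; have [[a Aa]|A0] := pselect (A !=set0); last first.
    exists (exist _ G (conj domG (@subset_refl _ G))) => s As.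
    by case: A0; exists s.
  pose U := \bigcup_(t in A) sval t.
  have domU : dominated_graph U /\ G `<=` U.
    split; last by move=> u Gu; exists a => //; exact: (svalP a).2.
    split.
    + by exists a => //; case: (svalP a).1.
    + move=> k u v [s As su] [t At tv].
      have [/asboolP st|/asboolP ts] := totA _ _ As At.
        by exists t => //; case: (svalP t).1 => _ + _; apply=> //; exact: st.
      by exists s => //; case: (svalP s).1 => _ + _; apply=> //; exact: ts.
    + by move=> u [s As su]; case: (svalP s).1 => _ _; exact.
  by exists (exist _ U domU) => s As; apply/asboolP => u su; exists s.
move=> [H [domH GH]] maxH.
have Htot x : {c | H (x, c)}.
  apply/cid; have [K domK [HK [c Kc]]] := dominated_graph_extend x domH.
  exists c; pose k : T := exist _ K (conj domK (subset_trans GH HK)).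
  by have /(congr1 sval)/= <- := maxH k (asboolT HK).
have [H0 HL Hp] := domH.
have Huniq x c d : H (x, c) -> H (x, d) -> c = d.
  suff le c' d' : H (x, c') -> H (x, d') -> c' <= d'.
    by move=> hc hd; apply/eqP; rewrite eq_le !le.
  move=> hc hd; have /Hp /= := HL (-1) _ _ hd hc.
  rewrite !scaleN1r addNr -(scale0r 0) pZ// mul0r addrC.
  by rewrite subr_le0.
pose f x : R^o := sval (Htot x).
have fP x : H (x, f x) := svalP (Htot x).
have flin : linear f.
  move=> a x y; apply: (Huniq (a *: x + y)); first exact: fP.
  exact: (HL a (x, f x) (y, f y)).
exists f; split=> // [x|[x c] /GH Hc] /=; first exact: (Hp _ (fP x)).
exact: Huniq (fP x) Hc.
Qed.

End HahnBanach.

(** * Functionals on a normed space *)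

Section dual_theory.
Context {R : realType} {X : normedModType R}.
Implicit Types (f g : dual X) (x : X).

Lemma dual0 f : f 0 = 0.
Proof. exact: linear0. Qed.

Lemma dualB f x y : f (x - y) = f x - f y.
Proof. exact: linearB. Qed.

Lemma dualD f x y : f (x + y) = f x + f y.
Proof. exact: linearD. Qed.

Lemma dualZ f a x : f (a *: x) = a * f x.
Proof. exact: linearZ. Qed.

Lemma bounded_dual (f : X -> R^o) (k : R) : linear f ->
  (forall x, `|f x| <= k * `|x|) -> exists F : dual X, F =1 f.
Proof.
move=> lf fk.
pose A := GRing.isLinear.Build R X R^o _ f lf.
pose F : {linear X -> R^o} := HB.pack f A.
suff cF : continuous f.
  have mF : f \in dual_mem (X := X) by apply/mem_set.
  by exists (Dual mF).
apply: (@bounded_linear_continuous _ _ _ F).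
apply/linear_boundedP; exists `|k|; split; first exact: normr_real.
move=> l kl x; rewrite (le_trans (fk x))// ler_wpM2r//.
by rewrite (le_trans (ler_norm _))// ltW.
Qed.

(** Domination by [k * `|x|] on the graph turns into the bound [k] for the norm
    of the extension. *)
Lemma dual_extension (G : set (X * R^o)) (k : R) : 0 <= k ->
  dominated_graph (fun x => k * `|x|) G ->
  exists2 f : dual X, `|f| <= k & forall u, G u -> f u.1 = u.2.
Proof.
move=> k0 /hahn_banach[].
- by move=> x y; rewrite -mulrDr ler_wpM2l// ler_normD.
- by move=> a x a0; rewrite normrZ ger0_norm// mulrCA.
move=> f [lf fk fG].
have fk' x : `|f x| <= k * `|x|.
  rewrite ler_norml fk andbT lerNl.
  pose A := GRing.isLinear.Build R X R^o _ f lf.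
  pose F : {linear X -> R^o} := HB.pack f A.
  by rewrite -[f x]/(F x) -linearN /= -(normrN x) fk.
have [F FE] := bounded_dual lf fk'.
exists F => [|u Gu]; last by rewrite FE fG.
by apply: dual_norm_le => // x; rewrite FE.
Qed.

Lemma norming_functional x :
  exists2 f : dual X, `|f| <= 1 & f x = `|x|.
Proof.
pose line := [set a *: (x, `|x| : R^o) | a in setT].
have [|f f1 fG] := @dual_extension line 1 ler01.
  split.
  - by exists 0 => //; rewrite scale0r.
  - move=> a _ _ [s _ <-] [t _ <-]; exists (a * s + t) => //.
    by rewrite scalerDl scalerA.
  - move=> _ [a _ <-] /=; rewrite mul1r normrZ ler_wpM2r//.
    exact: ler_norm.
exists f => //; rewrite -[RHS]scale1r -[x in LHS]scale1r.
by apply: (fG (1 *: (x, `|x| : R^o))); exists 1.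
Qed.

(** Induction on [n]: if [b n] does not vanish on the common kernel of its
    predecessors, say [b n w != 0], then [g - (g w / b n w) *: b n] vanishes on
    that kernel, since each of its vectors is, up to a multiple of [w], in the
    kernel of [b n] as well. *)
Lemma common_kernel_span (b : nat -> dual X) n g :
  (forall x, (forall i, (i < n)%N -> b i x = 0) -> g x = 0) ->
  exists c : nat -> R, g = \sum_(i < n) c i *: b i.
Proof.
elim: n g => [|n IH] g gb.
  by exists (fun=> 0); rewrite big_ord0; apply/val_inj/funext => x; exact: gb.
have [bn0|] :=
  pselect (forall x, (forall i, (i < n)%N -> b i x = 0) -> b n x = 0).
  have [|c ->] := IH g.
    move=> x bx; apply: gb => i; rewrite ltnS leq_eqVlt => /predU1P[->|].
      exact: bn0.
    exact: bx.
  exists (fun i => if i == n then 0 else c i).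
  rewrite big_ord_recr/= eqxx scale0r addr0; apply: eq_bigr => i _.
  by rewrite ltn_eqF.
move=> /existsNP[w /not_implyP[wb /eqP wn]].
pose a := g w / b n w.
have [|c gc] := IH (g - a *: b n).
  move=> x bx.
  have := gb (x - (b n x / b n w) *: w); rewrite dualB dualZ => h.
  rewrite -[LHS]/(g x - a * b n x) /a -{}h.
    by rewrite mulrAC [g w * _]mulrC mulrAC.
  move=> i; rewrite ltnS leq_eqVlt dualB dualZ => /predU1P[->|ni].
    by rewrite divfK ?subrr.
  by rewrite (bx i)// (wb i)// mulr0 subr0.
exists (fun i => if i == n then a else c i).
rewrite big_ord_recr/= eqxx -[LHS](subrK (a *: b n)) gc; congr (_ + _).
by apply: eq_bigr => i _; rewrite ltn_eqF.
Qed.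

End dual_theory.

(** The combinations with rational coefficients form the countable dense set. *)
Lemma separable_span (R : realType) (V : normedModType R) (b : nat -> V) :
  (forall v e, 0 < e -> exists n (c : nat -> R),
     `|v - \sum_(i < n) c i *: b i| < e) -> separable V.
Proof.
move=> bV; pose comb (s : seq rat) := \sum_(i < size s) ratr s`_i *: b i.
exists (range comb); first exact: (sub_countable (card_image_le _ _)).
move=> O [v Ov] oO.
have /nbhs_ballP[e /= e0 eO] : nbhs v O by exact: open_nbhs_nbhs.
have e20 : 0 < e / 2 by rewrite divr_gt0.
have [n [c vc]] := bV v (e / 2) e20.
pose r i : R := e / 2 / n.+1%:R / (1 + `|b i|).
have r0 i : 0 < r i by rewrite !divr_gt0// ltr_wpDr.
have /choice[q cq] : forall i, exists q : rat, `|c i - ratr q| < r i.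
  move=> i; have /rat_in_itvoo[q] : c i < c i + r i by rewrite ltrDl.
  rewrite in_itv/= => /andP[cq qr]; exists q.
  by rewrite ltr0_norm ?subr_lt0// opprB ltrBlDl.
exists (comb (mkseq q n)); split; last by exists (mkseq q n).
apply: eO; rewrite -ball_normE /= [e]splitr.
rewrite -(subrKA (\sum_(i < n) c i *: b i)) (le_lt_trans (ler_normD _ _))//.
rewrite ltr_leD// /comb size_mkseq -sumrB (le_trans (ler_norm_sum _ _ _))//.
rewrite (@le_trans _ _ (\sum_(i < n) (e / 2 / n.+1%:R)))//; last first.
  rewrite sumr_const card_ord -[leLHS]mulr_natr mulrAC ler_pdivrMr//.
  by rewrite ler_pM2l// ler_nat.
apply: ler_sum => i _; rewrite nth_mkseq// -scalerBl normrZ.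
rewrite -[leRHS](@divfK _ (1 + `|b i|)) ?gt_eqF ?ltr_wpDr//.
apply: ler_pM => //; first exact/ltW/cq.
by rewrite lerDr.
Qed.

(** * Completeness *)

Section dual_complete.
Context {R : realType} (X : normedModType R).

(** The pointwise limit of a Cauchy filter is linear, and a Cauchy filter is
    close to its pointwise limit uniformly on the unit ball. *)
Lemma dual_cauchy_cvg (F : set_system (dual X)) :
  ProperFilter F -> cauchy F -> cvg F.
Proof.
move=> PF /cauchyP cF.
have ev_le (f g : dual X) x : `|f x - g x| <= `|f - g| * `|x|.
  exact: (dual_normP (f - g)).
have ev_cvg x : cvg ((fun f : dual X => f x) @ F).
  apply/cauchy_cvgP/cauchy_exP => e e0.
  have x1 : 0 < 1 + `|x| by rewrite ltr_wpDr.
  (* the summand 1 avoids a division by zero when [x] is zero *)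
  have [f Ff] := cF _ (divr_gt0 e0 x1); exists (f x).
  suff : \forall g \near F, ball (f x) e ((g : dual X) x) by [].
  near=> g.
  rewrite -ball_normE /=; apply: (le_lt_trans (ev_le _ _ _)).
  rewrite (@le_lt_trans _ _ (`|f - g| * (1 + `|x|)))//.
    by rewrite ler_wpM2l// lerDr.
  rewrite -ltr_pdivlMr//; near: g.
  by apply: filterS Ff => g; rewrite -ball_normE.
pose l x : R^o := lim ((fun f : dual X => f x) @ F).
have lP x : (fun f : dual X => f x) @ F --> l x by exact: ev_cvg.
have ll : linear l.
  move=> a x y; apply: (cvg_unique _ (lP (a *: x + y))) => //.
  have -> : (fun f : dual X => f (a *: x + y)) = (fun f => a *: f x + f y).
    by apply/funext => f; exact: dual_linear.
  by apply: cvgD; [apply: cvgZr|]; exact: lP.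
have unif e : 0 < e ->
    \forall f \near F, forall x, `|(f : dual X) x - l x| <= e * `|x|.
  move=> e0; have e20 : 0 < e / 2 by rewrite divr_gt0.
  have [h Fh] := cF _ e20; near=> f => x.
  apply/ler_addgt0Pr => d d0.
  have hf : ball h (e / 2) f by near: f.
  have Fl : \forall g \near F, `|l x - (g : dual X) x| < d.
    by have /cvgrPdist_lt := lP x; exact.
  have [g [hg gl]] := filter_ex (filterI Fh Fl).
  rewrite -(subrKA (g x)) (le_trans (ler_normD _ _))// lerD//; last first.
    by rewrite distrC ltW.
  rewrite (le_trans (ev_le _ _ _))// ler_wpM2r// ltW//.
  by have := ball_splitr hf hg; rewrite -ball_normE.
have [f fl] := filter_ex (unif _ ltr01).
have lb x : `|l x| <= (`|f| + 1) * `|x|.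
  rewrite -[l x](subKr (f x)) mulrDl mul1r (le_trans (ler_normB _ _))//.
  by rewrite lerD ?dual_normP// -[leRHS]mul1r.
have [L LE] := bounded_dual ll lb.
apply/cvg_ex; exists L; apply/cvg_ballP => e e0.
have e20 : 0 < e / 2 by rewrite divr_gt0.
near=> g; rewrite -ball_normE /= (@le_lt_trans _ _ (e / 2))//.
  apply: dual_norm_le => [|x]; first exact: ltW.
  rewrite -[(L - g) x]/(L x - g x) LE distrC; move: x; near: g; exact: unif.
by rewrite ltr_pdivrMr// ltr_pMr// ltr1n.
Unshelve. all: by end_near. Qed.

HB.instance Definition _ := Uniform_isComplete.Build (dual X) dual_cauchy_cvg.

End dual_complete.


(** Completeness together with the rate of convergence, which passes to the
    limit. *)
Lemma tail_bound_cvg (R : realType) (V : completeNormedModType R)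
    (u : nat -> V) (r : nat -> R) :
  (forall n m, (n <= m)%N -> `|u n - u m| <= r n) -> r @ \oo --> 0 ->
  exists v, forall n, `|u n - v| <= r n.
Proof.
move=> ur r0.
have /cvg_ex[v uv] : cvg (u @ \oo).
  apply/cauchy_cvgP/cauchy_exP => e e0.
  have [N _ rN] : \forall n \near \oo, `|r n| < e.
    by move/cvgr0_norm_lt : r0; exact.
  exists (u N); exists N => // n /= Nn; rewrite -ball_normE /=.
  by rewrite (le_lt_trans (ur _ _ Nn))// (le_lt_trans (ler_norm _))// rN/=.
exists v => n; apply/ler_addgt0Pr => e e0.
have [N _ uN] : \forall n \near \oo, `|v - u n| < e.
  by move/cvgr_dist_lt : uv; exact.
pose m := maxn n N.
rewrite -(subrKA (u m)) (le_trans (ler_normD _ _))// lerD ?ur ?leq_maxl//.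
by rewrite distrC ltW// uN//= leq_maxr.
Qed.

Lemma isometry_closed_range (R : realType) (Y : completeNormedModType R)
    (V : normedModType R) (phi : {linear Y -> V}) :
  (forall y, `|phi y| = `|y|) -> closed_subspace (range phi).
Proof.
move=> phiN; split.
  split; first by apply/mem_set; exists 0 => //; rewrite linear0.
  move=> a u v /set_mem[x _ <-] /set_mem[y _ <-].
  by apply/mem_set; exists (a *: x + y) => //; rewrite linearP.
move=> v clv.
have /choice[y yv] : forall n, exists y, `|v - phi y| < n.+1%:R^-1.
  move=> n; have n0 : 0 < n.+1%:R^-1 :> R by rewrite invr_gt0.
  have [_ [[y _ <-]]] := clv _ (nbhsx_ballx v _ n0).
  by rewrite -ball_normE; exists y.
have [w yw] : exists w, forall n, `|y n - w| <= 2 * n.+1%:R^-1.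
  apply: tail_bound_cvg.
    move=> n m nm; rewrite -phiN linearB/= -(subrKA v) mulr_natl mulr2n.
    rewrite (le_trans (ler_normD _ _))// lerD//; first by rewrite distrC ltW.
    by rewrite (le_trans (ltW (yv _)))// lef_pV2 ?posrE// ler_nat.
  rewrite -(mulr0 (2 : R)); apply: cvgM; first exact: cvg_cst.
  exact: cvg_harmonic.
exists w => //; apply/esym/subr0_eq/eqP; rewrite -normr_le0.
apply/ler_addgt0Pr => e e0; rewrite add0r.
have e30 : 0 < e / 3 by rewrite divr_gt0.
have [N _ Ne] := near_infty_natSinv_lt (PosNum e30).
rewrite -(subrKA (phi (y N))) (le_trans (ler_normD _ _))//.
rewrite -linearB phiN (le_trans (lerD (ltW (yv N)) (yw N)))//.
by have := Ne N (leqnn N); move: (N.+1%:R^-1) => t /= te; lra.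
Qed.

(** * Slices of the unit ball and Simons' construction *)

(** Duality between the distance of [f] to the span of the [b i] and the norm
    of the restriction of [f] to their common kernel: if the latter were at
    most [d], a Hahn-Banach extension [g] of this restriction with norm at most
    [d] would differ from [f] by an element of the span. *)
Lemma functional_large_on_kernel (R : realType) (X : normedModType R)
    (b : nat -> dual X) n (f : dual X) (d : R) : 0 < d ->
  (forall c : nat -> R, d < `|f - \sum_(i < n) c i *: b i|) ->
  exists y, [/\ `|y| <= 1, forall i, (i < n)%N -> b i y = 0 & d <= f y].
Proof.
move=> d0 far; apply: contrapT => /forallNP small.
pose W x := forall i, (i < n)%N -> b i x = 0.
have fW x : W x -> f x <= d * `|x|.
  move=> Wx; have [->|x0] := eqVneq x 0.
    by rewrite dual0 normr0 mulr0.
  have nx : 0 < `|x| by rewrite normr_gt0.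
  rewrite -ler_pdivrMr// leNgt; apply/negP => dfx.
  apply: (small (`|x|^-1 *: x)); split.
  - by rewrite normrZ normfV normr_id mulVf// gt_eqF.
  - by move=> i ni; rewrite dualZ Wx// mulr0.
  - by rewrite dualZ mulrC ltW.
pose G := [set u : X * R^o | W u.1 /\ u.2 = f u.1].
have [|g gd gW] := @dual_extension _ _ G d (ltW d0).
  split.
  - by split=> /= [i ni|]; rewrite dual0.
  - move=> a u v [Wu fu] [Wv fv]; split=> /= [i ni|].
      by rewrite dual_linear (Wu i)// (Wv i)// scaler0 addr0.
    by rewrite dual_linear -fu -fv.
  - by move=> u [Wu ->]; exact: fW.
have [|c fg] := @common_kernel_span _ _ b n (f - g).
  move=> x Wx; rewrite -[LHS]/(f x - g x).
  by rewrite (gW (x, f x : R^o))// subrr.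
by have := far c; rewrite -fg opprB addrCA subrr addr0 ltNge gd.
Qed.

(** The weights of the series built below are dyadic, so that midpoints suffice
    to form the convex combinations that occur. *)
Section simons.
Context {R : realType} {Y : completeNormedModType R}.
Variables (C : nat -> set Y) (d : R).
Hypothesis d0 : 0 < d.
Hypothesis C_closed : forall n, closed (C n).
Hypothesis C_mid : forall n u v, C n u -> C n v -> C n (2^-1 *: (u + v)).
Hypothesis C_nonempty : forall n, C n !=set0.
Hypothesis C_decr : forall m n, (m <= n)%N -> C n `<=` C m.
Hypothesis C_norm : forall n u, C n u -> d <= `|u| <= 1.

Let w n : R := 2^-1 ^+ n.
Let w_gt0 n : 0 < w n. Proof. by rewrite exprn_gt0// invr_gt0. Qed.
Let wS n : w n = 2 * w n.+1.
Proof. by rewrite /w exprS mulrA mulfV ?mul1r// pnatr_eq0. Qed.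
(* the errors [e k] are such that the sum of the [e k / w k] is [d / 2] *)
Let e n : R := d * w n.+1 ^+ 2.
Let e_gt0 n : 0 < e n. Proof. by rewrite mulr_gt0// exprn_gt0. Qed.

Lemma almost_minimizer n x : exists z, C n z /\
  forall c, C n c -> `|x + w n *: z| <= `|x + w n *: c| + e n.
Proof.
pose S := [set `|x + w n *: c| | c in C n].
have infS : has_inf S.
  split; first by have [c Cc] := C_nonempty n; exists `|x + w n *: c|, c.
  by exists 0 => _ [c _ <-].
have [_ [z Cz <-] zS] := inf_adherent (e_gt0 n) infS.
exists z; split=> // c Cc; rewrite (le_trans (ltW zS))// lerD2r.
by apply: ge_inf; [case: infS | exists c].
Qed.

(** Let [x] be the sum of the [w n.+1 *: z n], where [z n] in [C n] almost
    minimises the norm of [X n + w n *: z] and [X n] is the partial sum. The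
    rescaled tail [T n = (x - X n) / w n] is an infinite convex combination of
    the [z k] with [n <= k], hence lies in [C n] and competes with [z n]. As [X
    n + w n *: T n = x], this bounds the norm of [X n + w n *: z n = 2 *: X
    n.+1 - X n] by that of [x], up to [e n]. For [f] norming [x] this reads [f
    (x - X n) - e n <= 2 * f (x - X n.+1)]: passing from [n] to [n.+1], the
    value [f (x - X n)] is at worst halved, up to [e n]. *)
Theorem simons : exists x, forall f : dual Y,
  (forall y, f y <= `|y|) -> f x = `|x| ->
  forall n, exists2 t, C n t & d / 2 <= f t.
Proof.
have /choice[next nextP] : forall p : nat * Y, exists z, C p.1 z /\
  forall c, C p.1 c -> `|p.2 + w p.1 *: z| <= `|p.2 + w p.1 *: c| + e p.1.
  by move=> [n x]; exact: almost_minimizer.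
pose fix X n : Y :=
  if n is k.+1 then X k + w k.+1 *: next (k, X k) else 0.
pose z n := next (n, X n).
have Cz n : C n (z n) := (nextP (n, X n)).1.
have zmin n c : C n c -> `|X n + w n *: z n| <= `|X n + w n *: c| + e n.
  exact: (nextP (n, X n)).2.
have XS n : X n.+1 = X n + w n.+1 *: z n by [].
(* [c] completes the partial sum from [n] to [m] to a convex combination *)
have tail n m c : (n <= m)%N -> C n c ->
    exists2 u, C n u & X m - X n + w m *: c = w n *: u.
  move=> /subnK <-; elim: (m - n)%N c => [|k IH] c Cc.
    by exists c => //; rewrite add0n subrr add0r.
  have Cz' : C n (z (k + n)%N) by apply: C_decr (Cz _); rewrite leq_addl.
  have [u Cu Xu] := IH _ (C_mid Cz' Cc); exists u => //; rewrite -Xu.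
  rewrite addSn XS [w (k + n)]wS scalerA mulrAC mulfV ?pnatr_eq0// mul1r.
  by rewrite scalerDr addrA; congr (_ + _); rewrite addrAC.
have Xbound n m : (n <= m)%N -> `|X n - X m| <= 2 * w n.
  move=> nm; have [c Cc] := C_nonempty n; have [u Cu Xu] := tail _ _ _ nm Cc.
  rewrite distrC -[X m - X n](addrK (w m *: c)) Xu (le_trans (ler_normB _ _))//.
  rewrite mulr_natl mulr2n !normrZ !gtr0_norm// lerD//.
    by rewrite ler_piMr ?(ltW (w_gt0 _))//; case/andP: (C_norm Cu).
  rewrite (@le_trans _ _ (w m))//.
    by rewrite ler_piMr ?(ltW (w_gt0 _))//; case/andP: (C_norm Cc).
  by rewrite /w ler_wiXn2l// ?invr_ge0// invf_le1 ?ler1n.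
have w0 : (fun n => 2 * w n) @ \oo --> 0.
  rewrite -(mulr0 (2 : R)); apply: cvgM; first exact: cvg_cst.
  by apply: cvg_expr; rewrite ger0_norm ?invr_ge0// invf_lt1// ltr1n.
have [x xX] := tail_bound_cvg Xbound w0.
pose T n := (w n)^-1 *: (x - X n).
have XT n : X n + w n *: T n = x.
  by rewrite scalerA mulfV ?gt_eqF// scale1r addrC subrK.
have CT n : C n (T n).
  apply: C_closed => A /nbhs_ballP[r /= r0 rA].
  have [c Cc] := C_nonempty n.
  have wr : 0 < w n * r / 3 by rewrite divr_gt0// mulr_gt0.
  have [N _ Nw] : \forall m \near \oo, `|2 * w m| < w n * r / 3.
    by have /cvgr0Pnorm_lt := w0; exact.
  pose m := maxn n N; have [u Cu Xu] := tail n m c (leq_maxl _ _) Cc.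
  exists u; split => //; apply: rA; rewrite -ball_normE /=.
  have -> : T n - u = (w n)^-1 *: ((x - X m) - w m *: c).
    rewrite -[u](scalerK (lt0r_neq0 (w_gt0 n))) -Xu -scalerBr; congr (_ *: _).
    by rewrite [X m - _ + _]addrAC opprB addrA subrK opprD addrA.
  rewrite normrZ gtr0_norm ?invr_gt0// ltr_pdivrMl//.
  have xm : `|x - X m| <= 2 * w m by rewrite distrC.
  have cm : `|w m *: c| <= w m.
    rewrite normrZ gtr0_norm// ler_piMr ?(ltW (w_gt0 _))//.
    by case/andP: (C_norm Cc).
  have := Nw m (leq_maxr _ _); rewrite /= gtr0_norm ?mulr_gt0// => Nwm.
  have := ler_normB (x - X m) (w m *: c); have := w_gt0 m.
  move: (w n * r) wr Nwm => a; lra.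
exists x => f fn fx n; exists (T n) => //.
have step k : f (x - X k) - e k <= 2 * f (x - X k.+1).
  have := le_trans (fn _) (zmin k _ (CT k)); rewrite XT -fx.
  by rewrite !dualB XS [w k]wS !dualD !dualZ; lra.
(* the factor [1 + w n] absorbs the errors [e k] for [k < n] *)
have : w n * (d / 2 * (1 + w n)) <= f (x - X n).
  elim: n => [|n IH].
    have := CT 0; have := XT 0; rewrite /w expr0 scale1r add0r => -> /C_norm.
    by rewrite subr0 fx mul1r => /andP[dx _]; lra.
  have := step n; rewrite /e; move: IH; rewrite [w n]wS; nra.
rewrite /T dualZ ler_pdivlMl//; apply: le_trans.
by rewrite ler_pM2l// ler_pMr ?divr_gt0// lerDl ltW.
Qed.

End simons.

(** * Separable boundaries *)

(** If a functional [f] is at distance at least [e] from the span of the [b i],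
    its slices of the unit ball along the common kernels meet the assumptions
    of [simons], while the boundary functionals become uniformly small on them.
    The last condition expresses, without mentioning distances, that the
    boundary functional lies in the closed span of [b]. *)
Theorem separable_dual_of_boundary (R : realType) (Y : completeNormedModType R)
    (b : nat -> dual Y) :
  (forall y, exists f : dual Y,
     [/\ forall z, f z <= `|z|, f y = `|y| &
         forall e, 0 < e -> exists N, forall z,
           (forall i, (i < N)%N -> b i z = 0) -> `|f z| <= e * `|z|]) ->
  separable (dual Y).
Proof.
move=> bdry; apply: (@separable_span _ _ b) => f e e0.
apply: contrapT => far; pose d := e / 2.
have d0 : 0 < d by rewrite divr_gt0.
pose C n :=
  [set y | [/\ `|y| <= 1, forall i, (i < n)%N -> b i y = 0 & d <= f y]].
(* [d <= f y] bounds the norm of [y] from below by [d / (1 + `|f|)] *)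
have f1 : 0 < 1 + `|f| by rewrite ltr_wpDr.
have r0 : 0 < d / (1 + `|f|) by rewrite divr_gt0.
have [||||| y yP] := @simons _ _ C _ r0.
- move=> n; have cl (h : Y -> R^o) A :
      continuous h -> closed A -> closed (h @^-1` A).
    by move/continuous_closedP; exact.
  rewrite (_ : C n = (fun y => `|y|) @^-1` [set r | r <= 1] `&`
      (\bigcap_(i in `I_n) (b i @^-1` [set r | r = 0]) `&`
      f @^-1` [set r | d <= r])).
    apply: closedI.
      by apply: cl; [exact: norm_continuous | exact: closed_le].
    apply: closedI; last first.
      by apply: cl; [exact: dual_continuous | exact: closed_ge].
    apply: closed_bigI => i _.
    by apply: cl; [exact: dual_continuous | exact: closed_eq].
  by apply/seteqP; split=> [y [? ? ?]|y [? [? ?]]].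
- move=> n u v [u1 bu fu] [v1 bv fv]; split.
  + rewrite normrZ gtr0_norm// ler_pdivrMl// mulr1.
    by rewrite (le_trans (ler_normD _ _))// (_ : 2 = 1 + 1)// lerD.
  + by move=> i ni; rewrite dualZ dualD bu// bv// addr0 mulr0.
  + by rewrite dualZ dualD; lra.
- move=> n; apply: functional_large_on_kernel d0 _ => c; rewrite ltNge.
  apply/negP => fc; apply: far; exists n, c; rewrite (le_lt_trans fc)//.
  by rewrite /d; lra.
- move=> m n mn y [y1 b0 fy]; split=> // i im; apply: b0.
  exact: leq_trans mn.
- move=> n y [y1 _ fy]; rewrite y1 andbT ler_pdivrMr// mulrC.
  rewrite (le_trans fy)// (le_trans (ler_norm _))//.
  by rewrite (le_trans (dual_normP _ _))// ler_wpM2r// lerDr.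
have [g [gn gy g0]] := bdry y.
set r := d / (1 + `|f|) in r0 yP.
have r30 : 0 < r / 3 by rewrite divr_gt0.
have [N gN] := g0 _ r30.
have [t [t1 bt ft] gt] := yP g gn gy N.
have := gN t bt; have := ler_norm (g t); nra.
Qed.

(** Enumerating a countable dense set with an inverse of an injection into
    [nat]; [x0] is the value at integers that code no point. *)
Lemma dense_sequence (T : topologicalType) (x0 : T) : separable T ->
  exists u : nat -> T, forall (x : T) (A : set T), nbhs x A ->
    exists n, A (u n).
Proof.
move=> [D /countable_injP[g ginj] Ddense].
pose u n := xget x0 [set p | D p /\ g p = n].
have uK p : D p -> u (g p) = p.
  move=> Dp; rewrite /u; case: xgetP => [q _ [Dq gq]|/(_ p)[]//].
  by apply: ginj => //; apply/mem_set.
exists u => x A /nbhs_interior xA.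
have [|p [Ap Dp]] := Ddense _ _ (open_interior A).
  by exists x; exact: nbhs_singleton xA.
by exists (g p); rewrite uK//; exact: interior_subset Ap.
Qed.

(** Boundary functionals are allowed to be multiples of differences of two
    values of [e], so that one statement covers molecules and point
    evaluations. If [z] is killed by the functionals [e (u n)] at points [u n]
    close to [p] and [q], then [e p z] and [e q z] are small. *)
Theorem separable_dual_of_separable_boundary (R : realType)
    (Y : completeNormedModType R) (M : topologicalType) (e : M -> dual Y) :
  separable M -> continuous e ->
  (forall y, exists (c : R) (p q : M),
     `|c *: (e p - e q)| <= 1 /\ (c *: (e p - e q)) y = `|y|) ->
  separable (dual Y).
Proof.
move=> sepM ce bdry; have [_ [p0 _]] := bdry 0.
have [u uP] := dense_sequence p0 sepM.
apply: (@separable_dual_of_boundary _ _ (e \o u)) => y.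
have [c [p [q [f1 fy]]]] := bdry y; exists (c *: (e p - e q)).
have fle (z : Y) : `|(c *: (e p - e q)) z| <= `|z|.
  by rewrite (le_trans (dual_normP _ _))// ler_piMl.
split=> // [z|r r0]; first exact: le_trans (ler_norm _) (fle z).
have c1 : 0 < 1 + `|c| by rewrite ltr_wpDr.
pose s := r / 2 / (1 + `|c|).
have s0 : 0 < s by rewrite !divr_gt0.
have near_e x : exists n, `|e x - e (u n)| < s.
  have /cvgrPdist_lt/(_ s s0)/uP[n xn] := ce x.
  by exists n.
have [[i pi] [j qj]] := (near_e p, near_e q).
exists (maxn i j).+1 => z uz.
have small x k : (k < (maxn i j).+1)%N -> `|e x - e (u k)| < s ->
    `|e x z| <= s * `|z|.
  move=> kN xk; have := dual_normP (e x - e (u k)) z.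
  rewrite -[X in `|X| <= _]/(e x z - e (u k) z) [e (u k) z]uz// subr0.
  by move=> /le_trans; apply; rewrite ler_wpM2r// ltW.
have {}pi := small p i (leq_maxl _ _) pi.
have {}qj := small q j (leq_maxr _ _) qj.
rewrite -[X in `|X|]/(c * (e p z - e q z)) normrM.
rewrite (@le_trans _ _ ((1 + `|c|) * (s * `|z| + s * `|z|)))//.
  apply: ler_pM => //; first by rewrite lerDr.
  by rewrite (le_trans (ler_normB _ _))// lerD.
suff -> : (1 + `|c|) * (s * `|z| + s * `|z|) = r * `|z| by [].
by rewrite /s; field; rewrite gt_eqF.
Qed.

(** * Norm attaining copies have separable dual *)

Section attaining.
Context {R : realType} {Y : completeNormedModType R}.

(** Here the boundary consists of the molecules, signed so that they take the
    value [`|y|] rather than its opposite. *)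
Lemma SNA_separable_dual (M : metricType R) (o : M)
    (phi : {linear Y -> lip0 o}) :
  separable M -> (forall y, `|phi y| = `|y|) -> range phi `<=` SNA o ->
  separable (dual Y).
Proof.
move=> sepM phiN phiA.
have phi_le y p q : `|phi y p - phi y q| <= mdist p q * `|y|.
  by rewrite mulrC -phiN; exact: lip0_normP.
have /choice[e eE] : forall p, exists f : dual Y, forall y, f y = phi y p.
  move=> p; apply: (@bounded_dual _ _ (fun y => phi y p) (mdist p o)).
    by move=> a x y; rewrite linearP.
  by move=> y; have := phi_le y p o; rewrite (lip0_base (phi y)) subr0.
have e_le p q : `|e p - e q| <= mdist p q.
  apply: dual_norm_le => [|y]; first exact: mdist_ge0.
  by rewrite -[X in `|X|]/(e p y - e q y) !eE.
apply: (separable_dual_of_separable_boundary sepM (e := e)).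
  move=> p; apply/cvgrPdist_lt => r r0.
  apply: filterS (nbhsx_ballx p r r0) => q; rewrite ballEmdist /=.
  exact: le_lt_trans.
move=> y; have [p [q [pq yE]]] : SNA o (phi y) by apply: phiA; exists y.
have pq0 : 0 < mdist p q by rewrite mdist_gt0.
exists (Num.sg (phi y p - phi y q) / mdist p q), p, q; split.
  rewrite normrZ normrM normfV (gtr0_norm pq0) -mulrA mulr_ile1//.
  - by rewrite mulr_ge0// invr_ge0 ltW.
  - by rewrite normr_sg lern1 leq_b1.
  - by rewrite ler_pdivrMl// mulr1.
rewrite -[LHS]/(_ * (e p y - e q y)) !eE.
by rewrite mulrAC -normrEsg -yE.
Qed.

Lemma NA_separable_dual (X : normedModType R) (phi : {linear Y -> dual X}) :
  separable X -> (forall y, `|phi y| = `|y|) -> range phi `<=` NA X ->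
  separable (dual Y).
Proof.
move=> sepX phiN phiA.
have phi_le y x : `|phi y x| <= `|x| * `|y|.
  by rewrite mulrC -phiN; exact: dual_normP.
have /choice[e eE] : forall x, exists f : dual Y, forall y, f y = phi y x.
  move=> x; apply: (@bounded_dual _ _ (fun y => phi y x) `|x|) => //.
  by move=> a y z; rewrite linearP.
have e_le x z : `|e x - e z| <= `|x - z|.
  apply: dual_norm_le => // y.
  by rewrite -[X in `|X|]/(e x y - e z y) !eE -dualB.
apply: (separable_dual_of_separable_boundary sepX (e := e)).
  move=> x; apply/cvgrPdist_lt => r r0.
  apply: filterS (nbhsx_ballx x r r0) => z; rewrite -ball_normE /=.
  exact: le_lt_trans.
move=> y; have [x x1 yE] : NA X (phi y) by apply: phiA; exists y.
exists (Num.sg (phi y x)), x, 0; split.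
  rewrite normrZ mulr_ile1//; first by rewrite normr_sg lern1 leq_b1.
  by rewrite (le_trans (e_le _ _))// subr0.
rewrite -[LHS]/(_ * (e x y - e 0 y)) !eE dual0 subr0.
by rewrite -normrEsg yE.
Qed.

End attaining.

(** * Norm attaining copies from a separable dual *)

Section bidual.
Context {R : realType} (Y : normedModType R).

(** A functional norming [y] shows at once that the embedding is isometric at
    [y] and that the image of [y] attains its norm. *)
Lemma bidual_embedding : exists phi : {linear Y -> dual (dual Y)},
  (forall y, `|phi y| = `|y|) /\ range phi `<=` NA (dual Y).
Proof.
have /choice[ev evE] : forall y, exists F : dual (dual Y), forall f, F f = f y.
  move=> y; apply: (@bounded_dual _ _ (fun f : dual Y => f y) `|y|) => // f.
  by rewrite mulrC; exact: dual_normP.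
have evL : linear ev.
  move=> a x y; apply/val_inj/funext => f /=.
  rewrite evE dual_linear -[RHS]/(a * ev x f + ev y f).
  by rewrite !evE.
pose A := GRing.isLinear.Build R Y (dual (dual Y)) _ ev evL.
pose phi : {linear Y -> dual (dual Y)} := HB.pack ev A.
have phiN y : `|phi y| = `|y|.
  apply/eqP; rewrite eq_le; apply/andP; split.
    apply: dual_norm_le => // f; rewrite evE mulrC; exact: dual_normP.
  have [f f1 fy] := norming_functional y.
  have := dual_normP (phi y) f; rewrite [phi y f]evE fy normr_id => /le_trans.
  by apply; rewrite ler_piMr// dual_norm_ge0.
exists phi; split=> // _ [y _ <-]; have [f f1 fy] := norming_functional y.
by exists f => //; rewrite phiN [phi y f]evE fy normr_id.
Qed.

End bidual.

(** A copy of the carrier that bears the distance of the norm, so that the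
    scalar field does not receive a second metric structure. *)
Definition normed_metric {R : realType} (X : normedModType R) : Type := X.

Section normed_metric.
Context {R : realType} (X : normedModType R).

HB.instance Definition _ := PseudoMetric.copy (normed_metric X) X.

Let dist (x y : normed_metric X) : R := `|(x : X) - (y : X)|.

Let dist_positivity x y : dist x y = 0 -> x = y.
Proof. by move/normr0_eq0/subr0_eq. Qed.

Let ball_dist (x : normed_metric X) d : ball x d = [set y | dist x y < d].
Proof. by rewrite -[LHS]/(ball (x : X) d) -ball_normE. Qed.

HB.instance Definition _ := PseudoMetric_isMetric.Build R (normed_metric X)
  (fun x y => normr_ge0 _) dist_positivity ball_dist.

(** For linear [f] the slope between [x] and [y] is a value of [f] at a vector
    of norm 1, so the Lipschitz constant is the norm of [f]; a point of the
    unit ball where a nonzero [f] attains its norm lies on the sphere and forms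
    with [0] a pair of extremal slope. The vector [x0] provides a pair of
    distinct points for the zero functional. *)
Lemma dual_lip0_embedding (x0 : X) : x0 != 0 ->
  exists J : {linear dual X -> lip0 ((0 : X) : normed_metric X)},
    (forall f, `|J f| = `|f|) /\
    forall f, NA X f -> SNA ((0 : X) : normed_metric X) (J f).
Proof.
move=> x00; set o : normed_metric X := 0 : X.
have lipf (f : dual X) : (f : normed_metric X -> R^o) \in lip0_mem o.
  apply/mem_set; split; first exact: dual0.
  by exists `|f| => x y; rewrite -dualB; exact: dual_normP.
pose j f := Lip0 (lipf f).
have jL : linear j by move=> a f g; exact/val_inj.
pose A := GRing.isLinear.Build R (dual X) (lip0 o) _ j jL.
pose J : {linear dual X -> lip0 o} := HB.pack j A.
have JN f : `|J f| = `|f|.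
  apply/eqP; rewrite eq_le; apply/andP; split.
    apply: lip0_norm_le => // x y; rewrite -[_ - _]/(f x - f y) -dualB.
    exact: dual_normP.
  apply: dual_norm_le => // x.
  have := @lip0_normP R (normed_metric X) o (J f) x o.
  by rewrite (lip0_base (J f)) subr0 -[mdist _ _]/(`|x - 0|) subr0.
exists J; split=> // f [x x1 fx].
have [f0|f0] := eqVneq (f x) 0.
  have {}f0 : f = 0 by apply: dual_norm_eq0; rewrite -[LHS]fx f0 normr0.
  exists (x0 : normed_metric X), o; split=> //.
  by rewrite f0 linear0 normr0 subr0 normr0 mul0r.
have nx : `|x| = 1.
  apply/eqP; rewrite eq_le x1 /= -(ler_pM2l (_ : 0 < `|f|)) -?fx ?normr_gt0//.
  by rewrite mulr1 [X in X * _]fx; exact: dual_normP.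
exists (x : normed_metric X), o; split.
  by apply: contraNneq f0 => ->; rewrite dual0.
rewrite JN (lip0_base (J f)) subr0 -[mdist _ _]/(`|x - 0|) subr0 nx divr1.
by rewrite -fx.
Qed.

End normed_metric.

(** The nonzero vector [x0] is what makes the underlying metric space have two
    points; it exists in [dual Y] unless [Y] is zero, and then the scalar field
    is taken instead. *)
Lemma separable_dual_NA (R : realType) (Y : normedModType R) :
  separable (dual Y) ->
  exists (X : completeNormedModType R) (x0 : X) (phi : {linear Y -> dual X}),
    [/\ x0 != 0, separable X, forall y, `|phi y| = `|y| & range phi `<=` NA X].
Proof.
move=> sepY; have [[y y0]|Y0] := pselect (exists y : Y, y != 0).
  have [phi [phiN phiA]] := bidual_embedding Y.
  have [f f1 fy] := norming_functional y.
  exists (dual Y), f, phi; split=> //.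
  by apply: contraNneq y0 => f0; rewrite -normr_eq0 -fy f0.
have {}Y0 (y : Y) : y = 0.
  by apply/eqP/negPn/negP => y0; apply: Y0; exists y.
exists (R^o : completeNormedModType R), (1 : R), \0; split=> //.
- exists (range ratr); last exact: dense_rat.
  exact: (sub_countable (card_image_le _ _)).
- by move=> y; rewrite [y]Y0 !normr0.
- by move=> _ [y _ <-]; exists 0; rewrite ?normr0//= dual0 normr0.
Qed.

(** * The equivalence *)

Theorem theorem3p3 (R : realType) (Y : completeNormedModType R) :
  [<-> exists (M : metricType R) (o : M) (Z : set (lip0 o)),
         (exists x y : M, x != y) /\ separable M /\
         closed_subspace Z /\ isometric_to_subspace Y Z /\ Z `<=` SNA o;
       exists (X : completeNormedModType R) (Z1 : set (dual X)),
         separable X /\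
         closed_subspace Z1 /\ isometric_to_subspace Y Z1 /\ Z1 `<=` NA X;
       separable (dual Y)].
Proof.
have to_NA : separable (dual Y) ->
    exists (X : completeNormedModType R) (Z1 : set (dual X)),
      separable X /\
      closed_subspace Z1 /\ isometric_to_subspace Y Z1 /\ Z1 `<=` NA X.
  move=> /separable_dual_NA[X [_ [phi [_ sepX phiN phiA]]]].
  exists X, (range phi); split=> //; split; first exact: isometry_closed_range.
  by split=> //; exists phi.
tfae.
- move=> [M [pt [_ [_ [sepM [_ [ [phi phiN <-] phiA]]]]]]].
  by apply: to_NA; exact: SNA_separable_dual phiA.
- move=> [X [_ [sepX [_ [ [phi phiN <-] phiA]]]]].
  exact: NA_separable_dual phiA.
- move=> /separable_dual_NA[X [x0 [phi [x00 sepX phiN phiA]]]].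
  have [J [JN JA]] := dual_lip0_embedding x00.
  pose psi : {linear Y -> lip0 _} := J \o phi.
  have psiN y : `|psi y| = `|y| by rewrite -[psi y]/(J (phi y)) JN.
  exists (normed_metric X), (0 : X), (range psi); split.
    by exists x0, (0 : X).
  split=> //; split; first exact: isometry_closed_range.
  split; first by exists psi.
  by move=> _ [y _ <-]; apply: JA; apply: phiA; exists y.
Qed.
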